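(* Let $q$ be a power of an odd prime $p$, $K$ an algebraic closure of $\mathbb{F}_q$, and $\mathrm{PGL}(2,q)$ the subgroup of $\mathrm{PGL}(3,q)$ generated by $(X,Y,Z)\mapsto(Z,Y,X)$, $(X,Y,Z)\mapsto(X+aY+\tfrac12a^2Z,\,Y+aZ,\,Z)$ ($a\in\mathbb{F}_q$) and $(X,Y,Z)\mapsto(b^2X,bY,Z)$ ($b\in\mathbb{F}_q^*$). If $\mathcal C$ is a $\mathrm{PGL}(2,q)$-invariant irreducible plane curve over $K$ of degree $d$ with $2<d<q^2-q$, then $\mathcal C$ is either the Hermitian curve $Y^{q+1}-(X^qZ+XZ^q)=0$, or it has homogeneous equation $$Y^{q+1}-(X^{q}Z+XZ^q)-\lambda(Y^{2}-2XZ)^{(q+1)/2}=0$$ for some $\lambda\in K$.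
   Context: A curve is invariant under a group of projectivities if every element maps it onto itself; irreducible means irreducible over $K$. *)

(* Defs.v *)
From HB Require Import structures.
From mathcomp Require Import all_boot all_order all_algebra.
From mathcomp Require Import mpoly.
Set Implicit Arguments. Unset Strict Implicit. Unset Printing Implicit Defensive.
Import Order.TTheory GRing.Theory.
Local Open Scope ring_scope.

Definition cX {K : fieldType} : {mpoly K[3]} := 'X_(0 : 'I_3).
Definition cY {K : fieldType} : {mpoly K[3]} := 'X_(1 : 'I_3).
Definition cZ {K : fieldType} : {mpoly K[3]} := 'X_(2 : 'I_3).

Definition linsubst {K : fieldType} (M : 'M[K]_3) : 3.-tuple {mpoly K[3]} :=
  [tuple \sum_(j < 3) M i j *: 'X_j | i < 3].

Definition pcomp {K : fieldType} (M : 'M[K]_3) (F : {mpoly K[3]}) :=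
  F \mPo linsubst M.

Definition swapXZ {K : fieldType} : 'M[K]_3 :=
  \matrix_(i < 3, j < 3) (if (i : nat) + j == 2 then 1 else 0)%N%:R.
Definition transl {K : fieldType} (a : K) : 'M[K]_3 :=
  \matrix_(i < 3, j < 3)
    (if i == j then 1
     else if ((i : nat) == 0) && ((j : nat) == 1) then a
     else if ((i : nat) == 0) && ((j : nat) == 2) then a ^+ 2 / 2%:R
     else if ((i : nat) == 1) && ((j : nat) == 2) then a
     else 0).
Definition dilat {K : fieldType} (b : K) : 'M[K]_3 :=
  \matrix_(i < 3, j < 3)
    (if i == j then
       (if (i : nat) == 0 then b ^+ 2 else if (i : nat) == 1 then b else 1)
     else 0).

Inductive inPGL2 {K : fieldType} (q : nat) : 'M[K]_3 -> Prop :=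
  | PGL2_swap : inPGL2 q swapXZ
  | PGL2_transl a : a ^+ q = a -> inPGL2 q (transl a)
  | PGL2_dilat b : b ^+ q = b -> b != 0 -> inPGL2 q (dilat b)
  | PGL2_mul M N : inPGL2 q M -> inPGL2 q N -> inPGL2 q (M *m N)
  | PGL2_inv M : inPGL2 q M -> inPGL2 q (invmx M).

Definition curve_invariant {K : fieldType} (M : 'M[K]_3) (F : {mpoly K[3]}) :=
  exists2 c : K, c != 0 & pcomp M F = c *: F.

(* Irreducibility over K of a polynomial in K[X,Y,Z] (units = nonzero constants). *)
Definition irreducible_mpoly {K : fieldType} (F : {mpoly K[3]}) :=
  (1 < msize F)%N /\
  forall G H : {mpoly K[3]}, F = G * H -> (msize G <= 1)%N \/ (msize H <= 1)%N.

Definition hermitian_curve {K : fieldType} (q : nat) : {mpoly K[3]} :=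
  cY ^+ q.+1 - (cX ^+ q * cZ + cX * cZ ^+ q).

Definition curve_family {K : fieldType} (q : nat) (lam : K) : {mpoly K[3]} :=
  hermitian_curve q - lam *: (cY ^+ 2 - 2%:R *: (cX * cZ)) ^+ (q.+1 %/ 2).

(* Main.v *)
Require Import Defs.
From HB Require Import structures.
From mathcomp Require Import all_boot all_order all_algebra.
From mathcomp Require Import all_solvable all_field.
From mathcomp Require Import mpoly ring zify.
Set Implicit Arguments. Unset Strict Implicit. Unset Printing Implicit Defensive.
Import Order.TTheory GRing.Theory.
Local Open Scope ring_scope.

(** The group contains, up to scalars, reflections of the orthogonal group of
    [Q0 = Y^2 - 2XZ]. If an irreducible form [F] of degree [d > 2] changed sign
    under one of them, the linear form of its mirror would divide [F]; hence [F]
    is fixed by the swap and the translations, [dilat b] multiplies it by [b^d],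
    and [d] is even.

    Let [L = u^q - u] and let [g(u) = F(u^2/2, u, 1)] be the restriction of [F] to
    the conic [Q0 = 0]. Invariance under translations gives [g = L^a g1] with
    [g1(0) != 0] and [q | deg g1]; the swap gives [2d = a(q+1) + deg g1]; the
    dilations give [a = d mod (q-1)]. Since [d] is even and [d < q^2 - q], these
    force [g = c L^(2k)] and [d = k(q+1)]. The Hermitian form [Q1] restricts to
    [- L^2 / 2], so some [F - c' Q1^k] vanishes on the conic and is therefore a
    multiple of [Q0]. By induction on [d], [F] is a power of [Q0] times a binary
    form in [Q1] and [Q0^((q+1)/2)]. Over the algebraically closed field [K] a
    binary form has a linear factor, and irreducibility leaves only that factor. *)

(** * Translation-invariant univariate polynomials *)

Section Univariate.
Variables (p h q : nat).
Hypotheses (hp : prime p) (hp_odd : odd p) (hh : (0 < h)%N) (hq : q = (p ^ h)%N).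

Lemma q_odd : odd q.
Proof. by rewrite hq oddX hp_odd orbT. Qed.

Lemma q_gt2 : (2 < q)%N.
Proof.
have p3 : (2 < p)%N by case: p hp hp_odd => [|[|[|]]].
by rewrite hq -(prednK hh) expnS; apply: leq_trans p3 (leq_pmulr _ _); rewrite expn_gt0; lia.
Qed.

(** Put r = q - 1, which is even, and N = M q. If a >= d, the equation leaves room only for N = 0.
    If d = a + r t, it reads r t (r + 2) = r d + M (r + 1), so r, being coprime to r + 1, divides M.
    Size and parity then leave M = 0. *)
Lemma conic_exponents (d a N : nat) : ~~ odd d -> (d < q ^ 2 - q)%N -> (q %| N)%N ->
  d.*2 = (a * q.+1 + N)%N -> (a = d %[mod q.-1])%N -> N = 0%N /\ ~~ odd a.
Proof.
have q2 := q_gt2; have qo := q_odd.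
move=> de dlt /dvdnP[M ->] E /eqP ad; have q0 : (0 < q)%N by lia.
rewrite -(prednK q0) in q2 qo dlt E *.
move: (q.-1) q2 qo dlt E ad => r /=; rewrite -mulnn => r2 ro dlt E ad.
have re : ~~ odd r by [].
have ad' : exists t, (a = d + r * t \/ d = a + r * t)%N.
  case: (leqP a d) ad => [le|/ltnW le].
    by rewrite eq_sym eqn_mod_dvd // => /dvdnP[t e]; exists t; right; lia.
  by rewrite eqn_mod_dvd // => /dvdnP[t e]; exists t; left; lia.
have parity : odd a = odd d.
  by case: ad' => t [->|->]; rewrite oddD oddM (negPf re) //= addbF.
rewrite parity; split=> //.
case: ad' => t [] e.
  subst a; by have : (d * r + r * t * r.+2 + M * r.+1 = 0)%N; [lia|case: (M) => // *; lia].
have E1 : (r * (t * r.+2) = r * d + M * r.+1)%N by move: E; rewrite e; lia.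
have r0 : (0 < r)%N by lia.
have /dvdnP[M' eM] : (r %| M)%N.
  rewrite -(@Gauss_dvdl _ _ r.+1) ?coprimenS //.
  by rewrite -(dvdn_addr _ (dvdn_mulr d (dvdnn r))) -E1 dvdn_mulr.
have E2 : (t * r.+2 = d + M' * r.+1)%N.
  apply/eqP; rewrite -(eqn_pmul2l r0) E1 eM mulnDr.
  by apply/eqP; lia.
(* From M' r (r + 1) = N <= 2d < 2 q (q - 1). *)
have M2 : (M' < 2)%N.
  rewrite -(@ltn_pmul2r (r * r.+1)) ?muln_gt0 ?r0 //.
  have -> : (M' * (r * r.+1) = M * r.+1)%N by rewrite eM; lia.
  by lia.
case: M' M2 E2 eM => [|[|]] // _ E2 eM; first by rewrite eM.
(* For M' = 1 the equation is t (r + 2) = d + r + 1, even on the left and odd on the right. *)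
have := congr1 odd E2.
by rewrite mul1n oddM oddD /= (negPf de) (negPf re) /= andbF.
Qed.

Variable K : closedFieldType.
Hypothesis hchar : p \in [pchar K].

Lemma pchar_natq (R : nzRingType) : p \in [pchar R] -> ([pchar R]).-nat q.
Proof.
move=> hR; rewrite hq pnatX; apply/orP; left.
by rewrite (eq_pnat _ (pcharf_eq hR)) pnat_id.
Qed.

Lemma exprDq (R : comNzRingType) (x y : R) : p \in [pchar R] ->
  (x + y) ^+ q = x ^+ q + y ^+ q.
Proof. by move=> hR; apply: exprDn_pchar; apply: pchar_natq. Qed.

Lemma natr_q : q%:R = 0 :> K.
Proof.
rewrite hq natrX; have /andP[_ /eqP ->] := hchar.
by rewrite expr0n; case: h hh.
Qed.

Lemma two_neq0 : 2%:R != 0 :> K.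
Proof.
rewrite -(dvdn_pcharf hchar) (dvdn_prime2 hp) //.
by apply: contraL hp_odd => /eqP ->.
Qed.

Lemma two_expq : 2%:R ^+ q = 2%:R :> K.
Proof. by rewrite -[2%:R]/(1 + 1) exprDq // !expr1n. Qed.

(** The vanishing polynomial of the subfield with q elements, whose members are described throughout
    by [a ^+ q = a]. *)
Definition Lq : {poly K} := 'X^q - 'X.

Lemma size_Lq : size Lq = q.+1.
Proof.
have := q_gt2 => hq2.
by rewrite size_polyDl ?size_polyXn // size_polyN size_polyX; lia.
Qed.

Lemma Lq_neq0 : Lq != 0.
Proof. by rewrite -size_poly_eq0 size_Lq. Qed.

(** In characteristic p the derivative of [Lq] is -1, so its roots are simple. *)
Lemma Lq_roots : exists2 rs : seq K, uniq rs &
  Lq = \prod_(x <- rs) ('X - x%:P).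
Proof.
have [rs E] := closed_field_poly_normal Lq.
have lc1 : lead_coef Lq = 1.
  rewrite lead_coefDl ?lead_coefXn // size_polyN size_polyX size_polyXn.
  by have := q_gt2; lia.
rewrite lc1 scale1r in E; exists rs => //.
rewrite -separable_prod_XsubC -E separable_poly.unlock /Lq !derivE.
rewrite coprimep_sym -mulr_natr -polyC_natr natr_q mulr0 sub0r -scaleN1r.
by rewrite coprimepZl ?oppr_eq0 ?oner_eq0 // coprime1p.
Qed.

Definition trans_inv (g : {poly K}) :=
  forall a : K, a ^+ q = a -> g \Po ('X + a%:P) = g.

Lemma trans_inv_Lq : trans_inv Lq.
Proof.
move=> a ha; rewrite /Lq comp_polyB comp_Xn_poly comp_polyX.
rewrite exprDq; last by rewrite (pchar_lalg {poly K}).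
by rewrite -polyC_exp ha; ring.
Qed.

(** Translations carry the root 0 to every element of the field of order q, and these are the simple
    roots of [Lq]. *)
Lemma trans_inv_dvd g : trans_inv g -> root g 0 -> Lq %| g.
Proof.
move=> gi g0; have [rs urs E] := Lq_roots.
rewrite E; apply: uniq_roots_dvdp; last by rewrite uniq_rootsE.
apply/allP => a ars.
have : root Lq a by rewrite E root_prod_XsubC.
rewrite /root /Lq !hornerE subr_eq0 => /eqP ha.
have <- : g.[0] = g.[a] by rewrite -[in LHS](gi a ha) horner_comp !hornerE.
exact: g0.
Qed.

Lemma trans_inv_quo g1 : trans_inv (Lq * g1) -> trans_inv g1.
Proof.
move=> gi a ha; apply: (mulfI Lq_neq0).
by rewrite -[in LHS](trans_inv_Lq ha) -comp_polyM gi.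
Qed.


(** The polynomial g - g(0) is invariant and vanishes at 0, so [Lq] divides it; the quotient is
    again invariant and has degree smaller by q. *)
Lemma trans_inv_size g : trans_inv g -> (q %| (size g).-1)%N.
Proof.
have [n] := ubnP (size g); elim: n g => // n IH g; rewrite ltnS => gn gi.
pose g0 := g - (g.[0])%:P.
have g0i : trans_inv g0 by move=> a ha; rewrite /g0 comp_polyB comp_polyC gi.
have [s1|s1] := leqP (size g) 1; first by case: (size g) s1 => [|[]].
have sg : size g0 = size g by rewrite size_polyDl // size_polyN (leq_ltn_trans (size_polyC_leq1 _)).
have /dvdpP[g1 E] : Lq %| g0.
  by apply: trans_inv_dvd => //; rewrite /root /g0 !hornerE subrr.
have g1n0 : g1 != 0 by apply: contraTneq s1 => e; rewrite -sg E e mul0r size_poly0.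
have sE : size g = (size g1 + q)%N.
  by rewrite -sg E size_mul ?Lq_neq0 // size_Lq addnS.
have := g1n0; rewrite -size_poly_gt0 => s1gt.
have {}IH : (q %| (size g1).-1)%N.
  apply: IH; first by have := q_gt2; move: gn; rewrite sE; move: (size g1) => s; lia.
  by apply: trans_inv_quo; rewrite mulrC -E.
have -> : (size g).-1 = ((size g1).-1 + q)%N by lia.
by rewrite dvdn_addl.
Qed.

Lemma trans_inv_factor g : g != 0 -> trans_inv g ->
  exists a g1, [/\ g = Lq ^+ a * g1, g1.[0] != 0 & trans_inv g1].
Proof.
have [n] := ubnP (size g); elim: n g => // n IH g; rewrite ltnS => gn g0 gi.
have [r0|r0] := boolP (root g 0); last by exists 0%N, g; rewrite mul1r.
have /dvdpP[g1 E] := trans_inv_dvd gi r0.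
have g1n0 : g1 != 0 by apply: contraNneq g0 => e; rewrite E e mul0r.
have sE : size g = (size g1 + q)%N.
  by rewrite E size_mul ?Lq_neq0 // size_Lq addnS.
have [||a [g2 [E2 n2 i2]]] := IH g1 _ g1n0.
- by have := q_gt2; move: gn; rewrite sE; move: (size g1) => s; lia.
- by apply: trans_inv_quo; rewrite mulrC -E.
by exists a.+1, g2; rewrite E E2 exprS; split=> //; ring.
Qed.

Theorem conic_invariant (g : {poly K}) d : g != 0 -> (size g <= d.*2.+1)%N ->
  trans_inv g -> (forall i, g`_i != 0 -> (i = d %[mod q.-1])%N) ->
  (forall i, (i <= d.*2)%N -> (g`_i == 0) = (g`_(d.*2 - i) == 0)) ->
  ~~ odd d -> (d < q ^ 2 - q)%N ->
  exists k c, [/\ c != 0, d = (k * q.+1)%N & g = c *: Lq ^+ k.*2].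
Proof.
move=> g0 sg gi gD gS de dlt.
have [a [g1 [E g1n0 g1i]]] := trans_inv_factor g0 gi.
have g1nz : g1 != 0 by apply: contraNneq g1n0 => ->; rewrite horner0.
pose N := (size g1).-1.
have qN : (q %| N)%N := trans_inv_size g1i.
have q2 := q_gt2.
have size_La : size (Lq ^+ a) = (a * q).+1.
  rewrite -[LHS]prednK ?size_poly_gt0 ?expf_neq0 ?Lq_neq0 //.
  by rewrite size_exp size_Lq mulnC.
have size_g : size g = (a * q + N).+1.
  rewrite E size_mul ?expf_neq0 ?Lq_neq0 // size_La /=.
  have : (0 < size g1)%N by rewrite size_poly_gt0.
  by rewrite /N; move: (size g1) => s; lia.
(* Since [Lq] is X (X^(q-1) - 1) and g1(0) is nonzero, a is the least exponent occurring in g. *)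
have EX : g = 'X^a * (('X^(q.-1) - 1) ^+ a * g1).
  by rewrite E mulrA -exprMn mulrBr mulr1 -exprS prednK // (ltn_trans _ q2).
have low i : (i < a)%N -> g`_i = 0 by move=> ia; rewrite EX coefXnM ia.
have ga : g`_a != 0.
  rewrite EX coefXnM ltnn subnn -horner_coef0 !hornerE /= expr0n.
  have -> : (q.-1 == 0)%N = false by lia.
  by rewrite mulf_neq0 // expf_neq0 // sub0r oppr_eq0 oner_eq0.
have gt : g`_(a * q + N) != 0.
  by have := g0; rewrite -lead_coef_eq0 lead_coefE size_g.
have top_le : (a * q + N <= d.*2)%N by rewrite -ltnS -size_g.
(* The symmetry i -> 2d - i of the support exchanges the least exponent a with the largest one, a q
   + N. Either strict inequality would push an exponent outside this range. *)
have ED : d.*2 = (a * q.+1 + N)%N.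
  have aq : (a <= a * q)%N by rewrite leq_pmulr // (ltn_trans _ q2).
  rewrite mulnS; apply/eqP; rewrite eqn_leq; apply/andP; split.
    have := ga; rewrite gS; last by rewrite (leq_trans (leq_trans aq (leq_addr N _))).
    apply: contraR; rewrite -ltnNge -addnA -ltn_subRL => lt.
    by rewrite nth_default // size_g.
  have := gt; rewrite gS //; apply: contraR; rewrite -ltnNge -addnA addnC => lt.
  by rewrite low // ltn_subLR.
have [N0 ae] := conic_exponents de dlt qN ED (gD _ ga).
exists a./2, g1.[0]; split=> //.
  by apply: double_inj; rewrite doubleMl even_halfK // ED N0 addn0.
rewrite even_halfK // E mulrC -mul_polyC; congr (_ * _).
have /size1_polyC-> : (size g1 <= 1)%N by rewrite -subn_eq0 subn1 -/N N0.
by rewrite hornerC.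
Qed.

(** The nonzero roots of [Lq] are q - 1 distinct roots of unity of order dividing q - 1, enough to
    force a primitive one among them. *)
Lemma Fq_prim_root : exists b : K, q.-1.-primitive_root b.
Proof.
have [rs urs E] := Lq_roots.
have q2 := q_gt2.
have srs : size rs = q by have := size_Lq; rewrite E size_prod_XsubC => -[].
pose rs' := filter (predC1 0) rs.
have hall : all q.-1.-unity_root rs'.
  apply/allP => a; rewrite mem_filter /= => /andP[a0 ars].
  have : root Lq a by rewrite E root_prod_XsubC.
  rewrite /root /Lq !hornerE subr_eq0 -[in a ^+ q](prednK (ltnW (ltnW q2))) exprS.
  rewrite -[X in _ == X]mulr1 (inj_eq (mulfI a0)) => /eqP e.
  by apply/unity_rootP.
have : has q.-1.-primitive_root rs'.
  apply: has_prim_root => //; [by lia|exact: filter_uniq|].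
  have := count_predC (pred1 (0 : K)) rs; rewrite srs (count_uniq_mem _ urs) => e.
  have {e} : (size rs' + (0%R \in rs) = q)%N by rewrite size_filter addnC.
  by case: (0 \in rs); move: (size rs') => s; lia.
by move/hasP => [b _ hb]; exists b.
Qed.

End Univariate.

(** * Evaluation of ternary forms *)

Definition pt3 (S : Type) (x y z : S) (i : 'I_3) : S := nth x [:: x; y; z] i.

(** The target ring S is left general: scalars give values at points, univariate polynomials give
    restrictions to parametrized curves, and ternary polynomials give substitutions. *)
Definition ev (K : fieldType) (S : comNzRingType) (f : {rmorphism K -> S})
  (x y z : S) (F : {mpoly K[3]}) : S := mmap f (pt3 x y z) F.

HB.instance Definition _ (K : fieldType) (S : comNzRingType)
  (f : {rmorphism K -> S}) (x y z : S) :=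
  GRing.RMorphism.copy (ev f x y z) (mmap f (pt3 x y z)).

Section Evaluation.
Variables (K : fieldType).
Implicit Types (F G : {mpoly K[3]}).

Section Rules.
Variables (S : comNzRingType) (f : {rmorphism K -> S}).
Implicit Types (x y z : S).

Lemma evC x y z c : ev f x y z c%:MP = f c.
Proof. exact: mmapC. Qed.

Lemma evX x y z : ev f x y z cX = x.
Proof. by rewrite /ev mmapX mmap1U. Qed.

Lemma evY x y z : ev f x y z cY = y.
Proof. by rewrite /ev mmapX mmap1U. Qed.

Lemma evZ x y z : ev f x y z cZ = z.
Proof. by rewrite /ev mmapX mmap1U. Qed.

Lemma ev_scale x y z c F : ev f x y z (c *: F) = f c * ev f x y z F.
Proof. exact: mmapZ. Qed.

Lemma ev_sum x y z F : ev f x y z F =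
  \sum_(m <- msupp F) f F@_m * (x ^+ m 0%R * y ^+ m 1%R * z ^+ m 2%R).
Proof.
apply: eq_bigr => m _; congr (_ * _).
rewrite /mmap1 !big_ord_recl big_ord0 mulr1 mulrA /pt3 /=.
by congr (_ ^+ m _ * _ ^+ m _ * _ ^+ m _); apply: val_inj.
Qed.

Lemma mdeg3 (m : 'X_{1..3}) : mdeg m = (m 0%R + m 1%R + m 2%R)%N.
Proof.
rewrite mdegE !big_ord_recl big_ord0 addn0 addnA.
by congr (m _ + m _ + m _)%N; apply: val_inj.
Qed.

Lemma ev_homog t x y z F d : F \is d.-homog ->
  ev f (t * x) (t * y) (t * z) F = t ^+ d * ev f x y z F.
Proof.
move=> /dhomogP hF; rewrite !ev_sum mulr_sumr [LHS]big_seq [RHS]big_seq.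
apply: eq_bigr => m /hF <-; rewrite [X in t ^+ X]mdeg3 !exprMn !exprD.
by rewrite [_ * (t ^+ m 1%R * _)]mulrACA [_ * (t ^+ m 2%R * _)]mulrACA [LHS]mulrCA.
Qed.

End Rules.

Lemma ev_comp (S T : comNzRingType) (f : {rmorphism K -> S}) (g : {rmorphism S -> T})
    (k : {rmorphism K -> T}) x y z F : (forall c, g (f c) = k c) ->
  g (ev f x y z F) = ev k (g x) (g y) (g z) F.
Proof.
move=> gf; rewrite !ev_sum rmorph_sum; apply: eq_bigr => m _.
by rewrite !rmorphM !rmorphXn gf.
Qed.


Definition subst3 (x y z : {mpoly K[3]}) := ev (@mpolyC 3 K) x y z.

HB.instance Definition _ x y z :=
  GRing.RMorphism.copy (subst3 x y z) (ev (@mpolyC 3 K) x y z).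

Lemma ev_subst3 (S : comNzRingType) (f : {rmorphism K -> S}) u v w x y z F :
  ev f u v w (subst3 x y z F) = ev f (ev f u v w x) (ev f u v w y) (ev f u v w z) F.
Proof. by apply: ev_comp => c; exact: evC. Qed.

Lemma subst3_comp u v w x y z F :
  subst3 u v w (subst3 x y z F) =
  subst3 (subst3 u v w x) (subst3 u v w y) (subst3 u v w z) F.
Proof. exact: ev_subst3. Qed.

Lemma subst3_id F : subst3 cX cY cZ F = F.
Proof.
rewrite -[RHS](comp_mpoly_id F) /subst3 /ev /comp_mpoly.
apply: eq_bigr => m _; congr (_ * _); apply: mmap1_eq => i.
rewrite tnth_map tnth_ord_tuple /pt3.
by case: i => -[|[|[|]]] // lt; congr ('X_ _); apply: val_inj.
Qed.

Lemma subst3X x y z : subst3 x y z cX = x. Proof. exact: evX. Qed.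
Lemma subst3Y x y z : subst3 x y z cY = y. Proof. exact: evY. Qed.
Lemma subst3Z x y z : subst3 x y z cZ = z. Proof. exact: evZ. Qed.
Lemma subst3_scale x y z c F : subst3 x y z (c *: F) = c *: subst3 x y z F.
Proof. by rewrite /subst3 ev_scale mul_mpolyC. Qed.

Lemma pcompE (M : 'M[K]_3) F : Defs.pcomp M F =
  subst3 (\sum_j M 0 j *: 'X_j) (\sum_j M 1 j *: 'X_j) (\sum_j M 2%:R j *: 'X_j) F.
Proof.
rewrite /Defs.pcomp /subst3 /ev /comp_mpoly.
apply: eq_bigr => m _; congr (_ * _); apply: mmap1_eq => i.
rewrite tnth_map tnth_ord_tuple /pt3.
case: i => -[|[|[|]]] // lt; apply: eq_bigr => j _;
  congr (fun_of_matrix M _ j *: _); exact: val_inj.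
Qed.

Lemma sum3E (A : 'I_3 -> K) :
  \sum_j A j *: 'X_j = A 0 *: cX + A 1 *: cY + A 2%:R *: cZ :> {mpoly K[3]}.
Proof.
rewrite !big_ord_recl big_ord0 addr0 addrA /cX /cY /cZ.
by congr (A _ *: 'X_ _ + A _ *: 'X_ _ + A _ *: 'X_ _); apply: val_inj.
Qed.

Lemma pcomp_swap F : Defs.pcomp swapXZ F = subst3 cZ cY cX F.
Proof.
by rewrite pcompE !sum3E !mxE /= !scale0r !scale1r ?(add0r, addr0).
Qed.

Lemma pcomp_transl a F : Defs.pcomp (transl a) F =
  subst3 (cX + a *: cY + (a ^+ 2 / 2%:R) *: cZ) (cY + a *: cZ) cZ F.
Proof.
by rewrite pcompE !sum3E !mxE /= !scale0r !scale1r ?(add0r, addr0).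
Qed.

Lemma pcomp_dilat b F : Defs.pcomp (dilat b) F = subst3 (b ^+ 2 *: cX) (b *: cY) cZ F.
Proof.
by rewrite pcompE !sum3E !mxE /= !scale0r !scale1r ?(add0r, addr0).
Qed.

Definition mdvd (l F : {mpoly K[3]}) := exists G, F = l * G.

Lemma mdvd0 l : mdvd l 0.
Proof. by exists 0; rewrite mulr0. Qed.

(** Congruence modulo l is respected by products and powers, hence by every monomial. *)
Lemma subst3_congr l x y z x' y' z' F :
  mdvd l (x - x') -> mdvd l (y - y') -> mdvd l (z - z') ->
  mdvd l (subst3 x y z F - subst3 x' y' z' F).
Proof.
move=> hx hy hz.
have mulc a b a' b' : mdvd l (a - a') -> mdvd l (b - b') -> mdvd l (a * b - a' * b').
  move=> [u hu] [v hv]; exists (u * b + a' * v).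
  have -> : a * b - a' * b' = (a - a') * b + a' * (b - b') by ring.
  by rewrite hu hv; ring.
have powc n a a' : mdvd l (a - a') -> mdvd l (a ^+ n - a' ^+ n).
  move=> ha; elim: n => [|n IH]; first by rewrite subrr; apply: mdvd0.
  by rewrite !exprS; apply: mulc.
rewrite /subst3 !ev_sum -sumrB; apply: big_ind => [|u v [A ->] [B ->]|m _].
- exact: mdvd0.
- by exists (A + B); rewrite mulrDr.
have [u hu] := mulc _ _ _ _ (mulc _ _ _ _ (powc (m 0%R) _ _ hx) (powc (m 1%R) _ _ hy))
  (powc (m 2%R) _ _ hz).
by exists ((F@_m)%:MP * u); rewrite -mulrBr hu mulrCA.
Qed.

End Evaluation.

(** * Divisibility by mirrors and by the conic *)

Section Homogeneous.
Variable (K : fieldType).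
Implicit Types (F G Q l : {mpoly K[3]}).

Lemma dhomog_cX : (cX : {mpoly K[3]}) \is 1.-homog.
Proof. by rewrite dhomogX; apply/eqP; apply: mdeg1. Qed.
Lemma dhomog_cY : (cY : {mpoly K[3]}) \is 1.-homog.
Proof. by rewrite dhomogX; apply/eqP; apply: mdeg1. Qed.
Lemma dhomog_cZ : (cZ : {mpoly K[3]}) \is 1.-homog.
Proof. by rewrite dhomogX; apply/eqP; apply: mdeg1. Qed.

Lemma msize_dhomog F d : F != 0 -> F \is d.-homog -> msize F = d.+1.
Proof.
move=> F0 hF; rewrite (dhomog_uniq F0 hF (dhomog_msize hF)) prednK //.
by rewrite lt0n msize_poly_eq0.
Qed.

(** Q times the component of G of degree i is homogeneous of degree i + k, so projecting the product
    to degree d + k keeps only i = d; then Q is cancelled. *)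
Lemma dhomog_quo Q G d k : Q != 0 -> Q \is k.-homog ->
  Q * G \is (d + k).-homog -> G \is d.-homog.
Proof.
move=> Q0 hQ hQG.
have EG := pihomog_partitionE (leqnn (msize G)).
have -> : G = \sum_(i < msize G) (if i == d :> nat then pihomog mdeg i G else 0).
  apply: (mulfI Q0); rewrite -[LHS](pihomog_dE hQG) [in LHS]EG !mulr_sumr raddf_sum.
  apply: eq_bigr => i _ /=; have hi := dhomogM hQ (pihomogP _ i G).
  case: eqP => [e|/eqP ne].
    by rewrite pihomog_dE // addnC -e.
  by rewrite mulr0 (pihomog_ne0 _ hi) // addnC eqn_add2r.
apply: rpred_sum => i _; case: eqP => [->|_]; [exact: pihomogP|exact: rpred0].
Qed.

Lemma irreducible_not_dvd F l : irreducible_mpoly F -> F != 0 ->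
  (1 < msize l < msize F)%N -> ~ mdvd l F.
Proof.
move=> [_ irr] F0 /andP[l1 lF] [G E].
have [|G1] := irr _ _ E; first by rewrite leqNgt l1.
have l0 : l != 0 by apply: contraNneq F0 => e; rewrite E e mul0r.
have G0 : G != 0 by apply: contraNneq F0 => e; rewrite E e mulr0.
move: lF; rewrite E msizeM //; move: (msize l) (msize G) G1 => a b; lia.
Qed.

Hypothesis h2 : 2%:R != 0 :> K.

(* A reflection is congruent to the identity modulo the linear form l of its
   mirror, so that [F \o r = - F] forces l to divide F. *)
Lemma reflection_char l x y z F e : F != 0 -> ~ mdvd l F ->
  mdvd l (cX - x) -> mdvd l (cY - y) -> mdvd l (cZ - z) ->
  subst3 x y z x = cX -> subst3 x y z y = cY -> subst3 x y z z = cZ ->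
  subst3 x y z F = e *: F -> e = 1.
Proof.
move=> F0 ndvd hx hy hz ix iy iz eF.
(* The substitution is an involution, so its multiplier is 1 or -1. *)
have e2 : e ^+ 2 == 1.
  have : e *: (e *: F) = F.
    by rewrite -[in e *: F]eF -subst3_scale -eF subst3_comp ix iy iz subst3_id.
  rewrite scalerA -expr2 => /eqP; rewrite -subr_eq0 -[X in _ - X]scale1r -scalerBl.
  by rewrite scaler_eq0 (negPf F0) orbF subr_eq0.
move: e2; rewrite sqrf_eq1 => /orP[/eqP //|/eqP e1]; case: ndvd.
have [G] := subst3_congr F hx hy hz; rewrite subst3_id eF e1 scaleN1r opprK => E.
exists (2%:R^-1 *: G); rewrite -scalerAr -E -mulr2n -scaler_nat scalerA mulVf //.
by rewrite scale1r.
Qed.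

Definition quadric : {mpoly K[3]} := cY ^+ 2 - 2%:R *: (cX * cZ).

Lemma dhomog_quadric : quadric \is 2.-homog.
Proof.
apply: rpredB; first exact: (dhomogMn 2 dhomog_cY).
by apply: rpredZ; exact: (dhomogM dhomog_cX dhomog_cZ).
Qed.

Lemma quadric_neq0 : quadric != 0.
Proof.
apply: contra_neq (oner_neq0 K) => /(congr1 (ev idfun 0 1 0)).
rewrite rmorph0 rmorphB rmorphXn /= ev_scale rmorphM /= evX evY evZ => <-.
by rewrite mul0r mulr0 subr0 expr1n.
Qed.

(** Restriction to the conic Y^2 = 2XZ through u -> (u^2/2, u, 1), which misses only the point
    (1:0:0). *)
Definition conic_res (F : {mpoly K[3]}) : {poly K} :=
  ev (@polyC K) (2%:R^-1 *: 'X^2) 'X 1 F.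

HB.instance Definition _ := GRing.RMorphism.copy conic_res
  (ev (@polyC K) (2%:R^-1 *: 'X^2) 'X 1).

Lemma conic_res_scale c F : conic_res (c *: F) = c *: conic_res F.
Proof. by rewrite /conic_res ev_scale mul_polyC. Qed.

Lemma conic_res_sum F : conic_res F =
  \sum_(m <- msupp F) (F@_m * 2%:R^-1 ^+ m 0%R) *: 'X^((m 0%R).*2 + m 1%R).
Proof.
rewrite /conic_res ev_sum; apply: eq_bigr => m _.
rewrite expr1n mulr1 exprZn -exprM mul2n -scalerAl -exprD.
by rewrite mul_polyC scalerA.
Qed.

Lemma size_conic_res F d : F \is d.-homog -> (size (conic_res F) <= d.*2.+1)%N.
Proof.
move=> /dhomogP hF; rewrite conic_res_sum.
apply: leq_trans (size_sum _ _ _) _; apply/bigmax_leqP_seq => m /hF + _.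
rewrite /= mdeg3 => e; apply: leq_trans (size_scale_leq _ _) _.
by rewrite size_polyXn; move: e; lia.
Qed.

Lemma coef_conic_res F i : (conic_res F)`_i =
  \sum_(m <- msupp F) F@_m * 2%:R^-1 ^+ m 0%R * (i == (m 0%R).*2 + m 1%R)%N%:R.
Proof.
rewrite conic_res_sum coef_sum; apply: eq_bigr => m _.
by rewrite coefZ coefXn.
Qed.

(** Setting Z = 0 turns the quadric into Y^2 and the product Z F into 0, so the cofactor G vanishes
    at Z = 0 and is itself a multiple of Z. *)
Lemma quadric_cancelZ F : mdvd quadric (cZ * F) -> mdvd quadric F.
Proof.
move=> [G E]; have G0 : subst3 cX cY 0 G = 0.
  have := congr1 (subst3 cX cY 0) E.
  rewrite !rmorphM rmorphB /= subst3_scale rmorphXn rmorphM /= subst3X subst3Y subst3Z.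
  rewrite mul0r mulr0 scaler0 subr0 => /esym/eqP; rewrite mulf_eq0 expf_eq0 /= => /orP[|/eqP //].
  move=> /eqP/(congr1 (ev idfun 0 1 0)); rewrite rmorph0 evY => /eqP.
  by rewrite oner_eq0.
have [G' EG] : mdvd cZ (G - subst3 cX cY 0 G).
  rewrite -[X in X - _]subst3_id; apply: subst3_congr; rewrite ?subrr ?subr0; try exact: mdvd0.
  by exists 1; rewrite mulr1.
have Z0 : cZ != 0 :> {mpoly K[3]}.
  apply: contra_neq (oner_neq0 K) => /(congr1 (ev idfun 0 0 1)).
  by rewrite rmorph0 evZ.
exists G'; apply: (mulfI Z0); rewrite E -[G]subr0 -[0]G0 EG; ring.
Qed.

(* Modulo the quadric, [(2Z)^d F = F(2ZX, 2ZY, 2Z^2)] equals [F(Y^2, 2ZY, 2Z^2)],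
   the homogenized restriction of [F] to the conic; then [Z] is cancelled. *)
Lemma quadric_dvd F d : F \is d.-homog -> conic_res F = 0 -> mdvd quadric F.
Proof.
move=> hF rF; pose t : {mpoly K[3]} := 2%:R * cZ.
have dvdtF : mdvd quadric (t ^+ d * F).
  have Et : t ^+ d * F = subst3 (t * cX) (t * cY) (t * cZ) F.
    by rewrite /subst3 (ev_homog _ _ _ _ _ hF) -/(subst3 _ _ _ _) subst3_id.
  have van : subst3 (cY ^+ 2) (t * cY) (t * cZ) F = 0.
    (* The right side is 2^d times the homogenization of [conic_res F] to degree 2d in Y and Z. A
       monomial X^a Y^b Z^c of F contributes to i = 2a + b, with Z-exponent b + 2c = 2d - i. *)
    transitivity (\sum_(i < d.*2.+1) 2%:R ^+ d * ((conic_res F)`_i)%:MP *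
                  (cY ^+ i * cZ ^+ (d.*2 - i)) : {mpoly K[3]}); last first.
      by apply: big1 => i _; rewrite rF coef0 mpolyC0 mulr0 mul0r.
    rewrite /subst3 ev_sum.
    under [RHS]eq_bigr => i _ do rewrite coef_conic_res rmorph_sum mulr_sumr mulr_suml.
    rewrite exchange_big /= [LHS]big_seq [RHS]big_seq; apply: eq_bigr => m mF.
    have := dhomogP _ _ _ hF _ mF; rewrite /= mdeg3 => dm.
    have lt : ((m 0%R).*2 + m 1%R < d.*2.+1)%N by move: dm; lia.
    rewrite (bigD1 (Ordinal lt)) //= big1 ?addr0; last first.
      move=> i; rewrite -val_eqE /= => /negPf ->.
      by rewrite mulr0 mpolyC0 mulr0 mul0r.
    rewrite eqxx mulr1.
    have -> : (d.*2 - ((m 0%R).*2 + m 1%R) = m 1%R + (m 2%R).*2)%N by move: dm; lia.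
    rewrite -dm /t; move: (m 0%R) (m 1%R) (m 2%R) => a b c.
    have e1 : (2%:R : {mpoly K[3]}) ^+ a * (2%:R^-1 ^+ a)%:MP = 1.
      have -> : (2%:R : {mpoly K[3]}) = 2%:R%:MP by rewrite rmorph_nat.
      by rewrite -rmorphXn -rmorphM -exprMn divff // expr1n.
    rewrite mpolyCM -!addnn !exprD !exprMn -[LHS]mul1r -[X in X * _ = _]e1.
    move: (2%:R ^+ a) (_ ^+ b) (_%:MP) (_%:MP) => *.
    ring.
  rewrite Et -[X in mdvd _ X]subr0 -van; apply: subst3_congr; rewrite ?subrr; try exact: mdvd0.
  by exists (-1); rewrite /quadric /t -mul_mpolyC rmorph_nat; ring.
have dvdZF : mdvd quadric (cZ ^+ d * F).
  have [G E] := dvdtF; exists ((2%:R^-1 ^+ d) *: G).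
  rewrite -scalerAr -E /t -mul_mpolyC exprMn.
  have -> : (2%:R : {mpoly K[3]}) = 2%:R%:MP by rewrite rmorph_nat.
  by rewrite -rmorphXn !mulrA -rmorphM -exprMn mulVf // expr1n rmorph1 mul1r.
elim: (d) dvdZF => [|n IH]; first by rewrite mul1r.
by rewrite exprS -mulrA => /quadric_cancelZ.
Qed.

(** On the parameter the translation acts as u -> u + a, because u^2/2 + a u + a^2/2 = (u +
    a)^2/2. *)
Lemma conic_res_transl a F :
  conic_res (Defs.pcomp (transl a) F) = conic_res F \Po ('X + a%:P).
Proof.
rewrite pcomp_transl /conic_res ev_subst3.
rewrite (ev_comp (k := @polyC K)); last by move=> c; rewrite /= comp_polyC.
rewrite !rmorphD /= !ev_scale evX evY evZ comp_polyZ comp_Xn_poly comp_polyX.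
rewrite -[1 \Po _]/((1%:P) \Po _) comp_polyC; congr ev.
- have e : 2%:R * (2%:R^-1)%:P = 1 :> {poly K} by rewrite -polyC_natr -polyCM divff.
  rewrite -!mul_polyC /= polyCM polyC_exp. ring: e.
- by rewrite mulr1.
Qed.

End Homogeneous.

(** * The swap acting on the conic *)

Section ClosedField.
Variable (K : closedFieldType).

(** If P vanishes everywhere, P + 1 has no root, so it is constant over an algebraically closed
    field. *)
Lemma poly_horner_eq0 (P : {poly K}) : (forall u, P.[u] = 0) -> P = 0.
Proof.
move=> P0; have [/closed_rootP[u]|/negbNE/eqP s1] := boolP (size (P + 1) != 1%N).
  by rewrite /root !hornerE P0 add0r oner_eq0.
have /size1_polyC E : (size (P + 1)%R <= 1)%N by rewrite s1.
have := congr1 (fun R : {poly K} => R.[0]) E; rewrite hornerC !hornerE P0 add0r => c1.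
by apply: (addIr 1); rewrite add0r E -c1.
Qed.

Lemma poly_eq_neq0 (P R : {poly K}) : (forall u, u != 0 -> P.[u] = R.[u]) -> P = R.
Proof.
move=> PR; apply/eqP; rewrite -subr_eq0.
(* The factor X takes care of the value at 0, where nothing is assumed. *)
have : 'X * (P - R) = 0.
  apply: poly_horner_eq0 => u; rewrite !hornerE.
  by have [->|/PR ->] := eqVneq u 0; [rewrite mul0r|rewrite subrr mulr0].
by move/eqP; rewrite mulf_eq0 polyX_eq0.
Qed.

Hypothesis h2 : 2%:R != 0 :> K.

Lemma horner_conic_res F (u : K) :
  (conic_res F).[u] = ev idfun (2%:R^-1 * u ^+ 2) u 1 F.
Proof.
rewrite /conic_res -[LHS]/(horner_eval u _).
rewrite (ev_comp (k := idfun)); last by move=> c; rewrite /= /horner_eval hornerC.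
by rewrite /= /horner_eval hornerZ hornerXn hornerX hornerC.
Qed.

(** The swap acts on the parameter as u -> 2/u: the point (1, u, u^2/2) is u^2/2 times the point of
    parameter 2/u. Hence g(u) = (u^2/2)^d g(2/u), which reverses the coefficients of g up to powers
    of 2. *)
Lemma conic_res_symm (F : {mpoly K[3]}) d i : F \is d.-homog -> subst3 cZ cY cX F = F ->
  (i <= d.*2)%N ->
  ((conic_res F)`_i == 0) = ((conic_res F)`_(d.*2 - i) == 0).
Proof.
move=> hF sF id; set g := conic_res F.
have sg : (size g <= d.*2.+1)%N by apply: size_conic_res.
(* R is (u^2/2)^d g(2/u) written as a polynomial in u. *)
pose R := \poly_(i < d.*2.+1) (g`_(d.*2 - i) * 2%:R ^+ (d.*2 - i) * 2%:R^-1 ^+ d).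
suff E : g = R.
  by rewrite [in LHS]E coef_poly ltnS id !mulf_eq0 !expf_eq0 invr_eq0 (negPf h2) !andbF !orbF.
apply: poly_eq_neq0 => u u0.
have -> : g.[u] = (2%:R^-1 * u ^+ 2) ^+ d * g.[2%:R / u].
  rewrite !horner_conic_res -[in LHS]sF ev_subst3 evX evY evZ -(ev_homog _ _ _ _ _ hF).
  congr (ev _ _ _ _ F); first by field; rewrite u0 h2.
    by field; rewrite u0 h2.
  by rewrite mulr1.
rewrite (horner_coef_wide _ sg) horner_poly mulr_sumr (reindex_inj rev_ord_inj) /=.
apply: eq_bigr => j _; rewrite subSS.
have jd : (j <= d.*2)%N by rewrite -ltnS.
rewrite exprMn -exprM mul2n -[in u ^+ d.*2](subnK jd) exprD exprMn [u^-1 ^+ _]exprVn.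
have : u ^+ (d.*2 - j) != 0 by rewrite expf_neq0.
by move: (u ^+ (d.*2 - j)) (2%:R^-1 ^+ d) => a b a0; field.
Qed.

End ClosedField.

(** * Dilations acting on the conic *)

Section Dilations.
Variable (K : fieldType).

Lemma coef_comp_scaleX (P : {poly K}) b i : (P \Po (b *: 'X))`_i = b ^+ i * P`_i.
Proof.
rewrite comp_polyE; under eq_bigr => j _ do rewrite exprZn scalerA.
rewrite -(poly_def _ (fun j => P`_j * b ^+ j)) coef_poly.
by case: ltnP => [_|/(nth_default 0) ->]; rewrite ?mulr0 // mulrC.
Qed.

Lemma conic_res_dilat b (F : {mpoly K[3]}) :
  conic_res (Defs.pcomp (dilat b) F) = conic_res F \Po (b *: 'X).
Proof.
rewrite pcomp_dilat /conic_res ev_subst3 !ev_scale evX evY evZ.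
rewrite (ev_comp (k := @polyC K)); last by move=> c; rewrite /= comp_polyC.
rewrite /= comp_polyZ comp_Xn_poly comp_polyX -[1 \Po _]/((1%:P) \Po _) comp_polyC.
by rewrite !mul_polyC exprZn !scalerA mulrC.
Qed.

End Dilations.

(** * Invariant ternary forms *)

Section Invariants.
Variables (p h q : nat) (K : closedFieldType).
Hypotheses (hp : prime p) (hp_odd : odd p) (hh : (0 < h)%N) (hq : q = (p ^ h)%N).
Hypothesis hchar : p \in [pchar K].
Implicit Types (F G : {mpoly K[3]}).

Let h2 : 2%:R != 0 :> K := two_neq0 hp hp_odd hchar.
Local Notation quad := (quadric K).
Local Notation herm := (@hermitian_curve K q).

(* [dilat b] is [b] times an isometry of the quadric, so the factor [b ^+ d] means
   that a form of degree [d] is fixed by the isometry itself. *)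
Definition orth_inv d F := [/\ F \is d.-homog,
  forall a : K, a ^+ q = a -> Defs.pcomp (transl a) F = F,
  Defs.pcomp swapXZ F = F &
  forall b : K, b ^+ q = b -> b != 0 -> Defs.pcomp (dilat b) F = b ^+ d *: F].

Lemma orth_inv_quadric : orth_inv 2 quad.
Proof.
split; first exact: dhomog_quadric.
- move=> a _; rewrite pcomp_transl /quadric rmorphB rmorphXn /= subst3_scale rmorphM /=.
  rewrite subst3X subst3Y subst3Z -!mul_mpolyC.
  have e : 2%:R * (2%:R^-1)%:MP = 1 :> {mpoly K[3]}.
    by rewrite -[2%:R](rmorph_nat (@mpolyC 3 K)) -rmorphM divff // rmorph1.
  rewrite mpolyCM !rmorphXn rmorph_nat /=.
  move: (_^-1)%:MP (a%:MP) e => t s e.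
  have e' : -2%:R * t = -1 by rewrite mulNr e.
  ring: e'.
- rewrite pcomp_swap /quadric rmorphB rmorphXn /= subst3_scale rmorphM /=.
  by rewrite subst3X subst3Y subst3Z [cZ * cX]mulrC.
- move=> b _ _; rewrite pcomp_dilat /quadric rmorphB rmorphXn /= subst3_scale rmorphM /=.
  rewrite subst3X subst3Y subst3Z -!mul_mpolyC rmorphXn /=; ring.
Qed.

(** The q-th power map is additive and fixes a, b and 2; expanding with it leaves polynomial
    identities. *)
Lemma orth_inv_hermitian : orth_inv q.+1 herm.
Proof.
have pM : p \in [pchar {mpoly K[3]}] by rewrite (pchar_lalg {mpoly K[3]}).
split.
- apply: rpredB; first by have := dhomogMn q.+1 (dhomog_cY K); rewrite mul1n.
  apply: rpredD.
    by have := dhomogM (dhomogMn q (dhomog_cX K)) (dhomog_cZ K); rewrite mul1n addn1.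
  by have := dhomogM (dhomog_cX K) (dhomogMn q (dhomog_cZ K)); rewrite mul1n add1n.
- move=> a ha; rewrite pcomp_transl /hermitian_curve rmorphB rmorphD !rmorphM !rmorphXn /=.
  rewrite subst3X subst3Y subst3Z ![_ ^+ q.+1]exprS !(exprDq hp hq) // !exprZn ha.
  rewrite expr_div_n -exprM mulnC exprM ha.
  rewrite (two_expq hp hq) // -!mul_mpolyC.
  have e : 2%:R * (2%:R^-1)%:MP = 1 :> {mpoly K[3]}.
    by rewrite -[2%:R](rmorph_nat (@mpolyC 3 K)) -rmorphM divff // rmorph1.
  rewrite mpolyCM rmorphXn /=.
  move: (_^-1)%:MP (a%:MP) (cX ^+ q) (cY ^+ q) (cZ ^+ q) e => t s x y z e.
  have e' : -2%:R * t = -1 by rewrite mulNr e.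
  ring: e'.
- rewrite pcomp_swap /hermitian_curve rmorphB rmorphD !rmorphM !rmorphXn /=.
  rewrite subst3X subst3Y subst3Z; move: (cX ^+ q) (cY ^+ _) (cZ ^+ q) => x y z; ring.
- move=> b hb _; rewrite pcomp_dilat /hermitian_curve rmorphB rmorphD !rmorphM !rmorphXn /=.
  rewrite subst3X subst3Y subst3Z !exprZn [b ^+ 2 ^+ q]exprAC !exprS hb -!mul_mpolyC rmorphM /=.
  rewrite expr0 mulr1 rmorphM /=; move: (cX ^+ q) (cY ^+ _) (cZ ^+ q) => x y z; ring.
Qed.

Lemma orth_inv1 : orth_inv 0 1.
Proof.
split; first exact: dhomog1.
- by move=> a _; rewrite pcomp_transl rmorph1.
- by rewrite pcomp_swap rmorph1.
- by move=> b _ _; rewrite pcomp_dilat rmorph1 scale1r.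
Qed.

Lemma orth_invM d e F G : orth_inv d F -> orth_inv e G -> orth_inv (d + e) (F * G).
Proof.
move=> [hF tF sF dF] [hG tG sG dG]; split; first exact: dhomogM.
- by move=> a ha; rewrite pcomp_transl rmorphM /= -!pcomp_transl tF // tG.
- by rewrite pcomp_swap rmorphM /= -!pcomp_swap sF sG.
- move=> b hb b0; rewrite pcomp_dilat rmorphM /= -!pcomp_dilat dF // dG //.
  by rewrite -scalerAl -scalerAr scalerA exprD.
Qed.

Lemma orth_invX d F n : orth_inv d F -> orth_inv (n * d) (F ^+ n).
Proof.
move=> hF; elim: n => [|n IH]; first exact: orth_inv1.
by rewrite exprS mulSn; apply: orth_invM.
Qed.

Lemma orth_invB d c F G : orth_inv d F -> orth_inv d G -> orth_inv d (F - c *: G).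
Proof.
move=> [hF tF sF dF] [hG tG sG dG]; split; first by rewrite rpredB // rpredZ.
- by move=> a ha; rewrite pcomp_transl rmorphB /= subst3_scale -!pcomp_transl tF // tG.
- by rewrite pcomp_swap rmorphB /= subst3_scale -!pcomp_swap sF sG.
- move=> b hb b0; rewrite pcomp_dilat rmorphB /= subst3_scale -!pcomp_dilat dF // dG //.
  by rewrite scalerBr !scalerA mulrC.
Qed.

(** The quadric is nonzero and satisfies the same invariance in degree 2, so it cancels from each
    identity. *)
Lemma orth_inv_quo d G : orth_inv d.+2 (quad * G) -> orth_inv d G.
Proof.
have [hQ tQ sQ dQ] := orth_inv_quadric; have Q0 := quadric_neq0 K.
move=> [hF tF sF dF]; split.
- by apply: (dhomog_quo Q0 hQ); rewrite addn2.
- move=> a ha; apply: (mulfI Q0).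
  by rewrite -[in RHS](tF _ ha) -[in LHS](tQ _ ha) !pcomp_transl rmorphM.
- by apply: (mulfI Q0); rewrite -[in RHS]sF -[in LHS]sQ !pcomp_swap rmorphM.
- move=> b hb b0; apply: (mulfI Q0).
  apply: (@scalerI _ _ (b ^+ 2)); first by rewrite expf_neq0.
  rewrite -scalerAr scalerA -exprD add2n -dF // scalerAl -dQ //.
  by rewrite !pcomp_dilat rmorphM.
Qed.

(** With 2^q = 2 the restriction is u^(q+1) - (u^(2q) + u^2)/2, a perfect square up to the factor
    -1/2. *)
Lemma conic_res_hermitian : conic_res herm = - 2%:R^-1 *: Lq q K ^+ 2.
Proof.
rewrite /conic_res rmorphB rmorphD !rmorphM !rmorphXn /= evX evY evZ.
rewrite exprZn exprVn (two_expq hp hq) // expr1n !mulr1 -exprM mulnC exprM /Lq exprS.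
have e : 2%:R * (2%:R^-1)%:P = 1 :> {poly K} by rewrite -polyC_natr -polyCM divff.
rewrite -!mul_polyC polyCN.
move: (_^-1)%:P ('X^q) e => t x e.
ring: e.
Qed.

Lemma orth_inv_conic_res d F : orth_inv d F -> ~~ odd d -> (d < q ^ 2 - q)%N ->
  conic_res F != 0 ->
  exists k c, [/\ c != 0, d = (k * q.+1)%N & conic_res F = c *: Lq q K ^+ k.*2].
Proof.
move=> [hF tF sF dF] de dlt g0.
apply: (conic_invariant hp hp_odd hh hq hchar) => //.
- exact: size_conic_res.
- by move=> a ha; rewrite -conic_res_transl // tF.
(* For b of order q - 1, comparing coefficients gives b^i g_i = b^d g_i, so i and d agree modulo q -
   1 wherever g_i is nonzero. *)
- move=> i gi; have [b hb] := Fq_prim_root hp hp_odd hh hq hchar.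
  have q2 := q_gt2 hp hp_odd hh hq.
  have b1 : b ^+ q.-1 = 1 := prim_expr_order hb.
  have b0 : b != 0.
    apply: contra_eq_neq b1 => ->; rewrite expr0n.
    have -> : (q.-1 == 0)%N = false by case: (q) q2 => [|[|]].
    by rewrite eq_sym oner_eq0.
  have bq : b ^+ q = b by rewrite -[in b ^+ q](ltn_predK q2) exprS b1 mulr1.
  apply/eqP; rewrite -(eq_prim_root_expr hb) -subr_eq0.
  have : b ^+ i * (conic_res F)`_i = b ^+ d * (conic_res F)`_i.
    have <- : (conic_res (Defs.pcomp (dilat b) F))`_i = b ^+ d * (conic_res F)`_i.
      by rewrite dF // /conic_res ev_scale coefCM.
    by rewrite conic_res_dilat coef_comp_scaleX.
  move/eqP; rewrite -subr_eq0 -mulrBl mulf_eq0 (negPf gi) orbF => //.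
- move=> i; apply: conic_res_symm => //; by rewrite -pcomp_swap.
Qed.

End Invariants.

(** * Binary forms evaluated at two algebra elements *)

Section BinaryForms.
Variables (K : fieldType) (S : comAlgType K) (A B : S).
Implicit Types P R : {poly K}.

(** The degree-k homogenization of P at (A, B). The degree k is formal: P may have smaller degree,
    and then powers of B split off. Coefficients beyond k are dropped, whence the size bounds
    below. *)
Definition binform k P : S := \sum_(j < k.+1) P`_j *: (A ^+ j * B ^+ (k - j)).

Lemma binformD k P R : binform k (P + R) = binform k P + binform k R.
Proof. by rewrite -big_split; apply: eq_bigr => j _; rewrite coefD scalerDl. Qed.

Lemma binformZ k c P : binform k (c *: P) = c *: binform k P.
Proof. by rewrite scaler_sumr; apply: eq_bigr => j _; rewrite coefZ scalerA. Qed.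

Lemma binform_Xn k : binform k 'X^k = A ^+ k.
Proof.
rewrite /binform big_ord_recr big1 /= => [|j _].
  by rewrite coefXn eqxx subnn scale1r mulr1 add0r.
by rewrite coefXn (ltn_eqF (ltn_ord j)) scale0r.
Qed.

Lemma binformS k P : (size P <= k.+1)%N -> binform k.+1 P = B * binform k P.
Proof.
move=> sP; rewrite /binform big_ord_recr /= (nth_default _ sP) scale0r addr0 mulr_sumr.
apply: eq_bigr => j _; rewrite subSn -1?ltnS // exprS -scalerAr; congr (_ *: _).
by rewrite mulrCA.
Qed.

Lemma binform_addn k i P : (size P <= k.+1)%N ->
  binform (i + k) P = B ^+ i * binform k P.
Proof.
move=> sP; elim: i => [|i IH]; first by rewrite mul1r.
rewrite addSn binformS ?IH ?exprS ?mulrA //.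
by rewrite (leq_trans sP) // ltnS leq_addl.
Qed.

Lemma binform_mulX k P : binform k.+1 (P * 'X) = A * binform k P.
Proof.
rewrite /binform big_ord_recl /= coefMX scale0r add0r mulr_sumr.
apply: eq_bigr => j _; rewrite coefMX /= subSS exprS -scalerAr mulrA //.
Qed.

Lemma binform_linear_factor k P z : (size P <= k.+1)%N ->
  binform k.+1 (P * ('X - z%:P)) = (A - z *: B) * binform k P.
Proof.
move=> sP; rewrite mulrBr -scaleN1r binformD binform_mulX binformZ mulrC.
rewrite [P * _]mulrC mul_polyC binformZ binformS // scaleN1r mulrBl.
by rewrite scalerAl mulrC.
Qed.

End BinaryForms.

(** * Descent by the quadric, and irreducible members of the pencil *)

Section Structure.
Variables (p h q : nat) (K : closedFieldType).
Hypotheses (hp : prime p) (hp_odd : odd p) (hh : (0 < h)%N) (hq : q = (p ^ h)%N).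
Hypothesis hchar : p \in [pchar K].
Implicit Types (F G : {mpoly K[3]}).

Let h2 : 2%:R != 0 :> K := two_neq0 hp hp_odd hchar.
Local Notation quad := (quadric K).
Local Notation herm := (@hermitian_curve K q).
Local Notation m := (q.+1)./2.
Local Notation pencil := (binform herm (quad ^+ m)).

(** Induction on half the degree: each division by the quadric lowers e by 1. The form F may be 0,
    represented by P = 0, since the subtraction below can leave nothing. *)
Lemma orth_inv_structure e F : orth_inv q e.*2 F -> (e.*2 < q ^ 2 - q)%N ->
  exists r k (P : {poly K}), [/\ e = (r + m * k)%N, (size P <= k.+1)%N &
    F = quad ^+ r * pencil k P].
Proof.
have qm : q.+1 = m.*2 by rewrite even_halfK //= negbK (q_odd hp_odd hq).
elim: e F => [|e IH] F hF elt.
  have [hd _ _ _] := hF.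
  have /msize1_polyC -> : (msize F <= 1)%N.
    by have [->|F0] := eqVneq F 0; rewrite ?msize0 // (msize_dhomog F0 hd).
  exists 0%N, 0%N, (F@_0%MM)%:P; rewrite muln0 size_polyC_leq1; split=> //.
  by rewrite /binform big_ord_recl big_ord0 coefC /= addr0 !mul1r alg_mpolyC.
have descend G : orth_inv q e.+1.*2 (quad * G) -> exists r k (P : {poly K}),
    [/\ e = (r + m * k)%N, (size P <= k.+1)%N & G = quad ^+ r * pencil k P].
  rewrite doubleS => /(orth_inv_quo hp hp_odd hchar)/IH; apply.
  by apply: leq_ltn_trans elt; rewrite leq_double.
have [g0|g0] := eqVneq (conic_res F) 0.
  have [hd _ _ _] := hF; have [G EF] := quadric_dvd h2 hd g0.
  rewrite EF in hF *; have [r [k [P [-> sP ->]]]] := descend _ hF.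
  by exists r.+1, k, P; rewrite exprS -mulrA; split.
have [|k [c [c0 dk gE]]] := orth_inv_conic_res hp hp_odd hh hq hchar hF _ elt g0.
  by rewrite odd_double.
(* The Hermitian form restricts to -1/2 times the square of [Lq]; the factor (-2)^k compensates its
   k-th power. *)
pose c' := c * (- 2%:R) ^+ k.
have hF' : orth_inv q e.+1.*2 (F - c' *: herm ^+ k).
  by apply: orth_invB => //; rewrite dk; apply: orth_invX;
  exact: orth_inv_hermitian hp hp_odd hq hchar.
have [G EF] : mdvd quad (F - c' *: herm ^+ k).
  have [hd _ _ _] := hF'; apply: (quadric_dvd h2 hd).
  rewrite rmorphB /= conic_res_scale rmorphXn /= (conic_res_hermitian hp hp_odd hq hchar) gE.
  rewrite exprZn -exprM -mul2n scalerA /c' -mulrA -exprMn mulNr mulrN opprK divff //.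
  by rewrite expr1n mulr1 subrr.
rewrite EF in hF'; have [r [k' [P [er sP EG]]]] := descend _ hF'.
have m0 : (0 < m)%N by have := q_gt2 hp hp_odd hh hq; case: (q) => [|[|]].
(* Comparing degrees, m k = r + 1 + m k', so the power r + 1 of the quadric is the power k - k' of
   [quad ^+ m], and both summands lie in the pencil's degree k. *)
have ek : e.+1 = (m * k)%N.
  by apply: double_inj; rewrite dk {1}qm -doubleMr mulnC.
have kk : (k' <= k)%N.
  by rewrite -(leq_pmul2l m0) -ek er; lia.
have rk : r.+1 = (m * (k - k'))%N by rewrite mulnBr -ek er; lia.
exists 0%N, k, (P + c' *: 'X^k); split=> //.
  apply: leq_trans (size_polyD _ _) _; rewrite geq_max (leq_trans sP) //=.
  by apply: leq_trans (size_scale_leq _ _) _; rewrite size_polyXn.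
rewrite mul1r binformD binformZ binform_Xn -[k in pencil k P](subnK kk).
rewrite binform_addn // -exprM -rk exprS -mulrA -EG -EF subrK //.
Qed.

(** The degree exceeds 2, so the quadric cannot divide F and r = 0. A root z of P gives the factor
    [herm - z *: quad ^+ m], and irreducibility makes the cofactor constant. *)
Lemma pencil_member F r k (P : {poly K}) : irreducible_mpoly F -> (3 < msize F)%N ->
  (size P <= k.+1)%N -> F = quad ^+ r * pencil k P ->
  exists lam c, c != 0 /\ F = c *: (herm - lam *: quad ^+ m).
Proof.
move=> irr sF sP EF.
have F0 : F != 0 by apply: contraTneq sF => ->; rewrite msize0.
have sQ : msize quad = 3%N by apply: msize_dhomog (quadric_neq0 K) (dhomog_quadric K).
have ndQ : ~ mdvd quad F by apply: irreducible_not_dvd => //; rewrite sQ.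
case: r EF => [|r] EF; last first.
  by case: ndQ; exists (quad ^+ r * pencil k P); rewrite mulrA -exprS.
rewrite mul1r in EF.
case: k sP EF => [|k] sP EF.
  move: sF; rewrite EF (size1_polyC sP) /binform big_ord_recl big_ord0 coefC /= addr0 mulr1.
  by rewrite alg_mpolyC msizeC; case: (_ != 0).
have m0 : (0 < m)%N by have := q_gt2 hp hp_odd hh hq; case: (q) => [|[|]].
have [/closed_rootP[z /factor_theorem[P1 EP]]|/negbNE/eqP s1] :=
  boolP (size P != 1%N); last first.
  (* Without a root P is constant, so [quad ^+ m] splits off from its homogenization of positive
     degree. *)
  case: ndQ; exists (quad ^+ m.-1 * pencil k P).
  by rewrite mulrA -exprS prednK // -binformS // s1.
have sP1 : (size P1 <= k.+1)%N.
  have [->|P10] := eqVneq P1 0; first by rewrite size_poly0.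
  by move: sP; rewrite EP size_mul ?polyXsubC_eq0 // size_XsubC addn2.
rewrite EP binform_linear_factor // in EF.
have hhom : herm - z *: quad ^+ m \is q.+1.-homog.
  have [hd _ _ _] := orth_inv_hermitian hp hp_odd hq hchar.
  apply: rpredB => //; apply: rpredZ.
  have := dhomogMn m (dhomog_quadric K).
  by rewrite mul2n even_halfK //= negbK (q_odd hp_odd hq).
have h0 : herm - z *: quad ^+ m != 0.
  by apply: contraNneq F0 => e; rewrite EF e mul0r.
case: (irr.2 _ _ EF) => [|/msize1_polyC E1]; first by rewrite (msize_dhomog h0 hhom).
rewrite E1 in EF; exists z, ((pencil k P1)@_0%MM); split.
  by apply: contraNneq F0 => e; rewrite EF e mpolyC0 mulr0.
by rewrite {1}EF mulrC mul_mpolyC.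
Qed.

Lemma irreducible_orth_inv F d : F != 0 -> F \is d.-homog -> irreducible_mpoly F ->
  (2 < d)%N -> (forall M : 'M[K]_3, inPGL2 q M -> curve_invariant M F) ->
  orth_inv q d F /\ ~~ odd d.
Proof.
move=> F0 hF irr d2 inv.
have sF := msize_dhomog F0 hF.
have ndl l : l \is 1.-homog -> l != 0 -> ~ mdvd l F.
  move=> hl l0; apply: irreducible_not_dvd => //.
  by rewrite (msize_dhomog l0 hl) sF ltnS; lia.
have linX (b : K) : ~ mdvd (cX - b *: cZ) F.
  apply: ndl; first by rewrite rpredB ?rpredZ ?dhomog_cX ?dhomog_cZ.
  apply: contra_neq (oner_neq0 K) => /(congr1 (ev idfun 1 0 0)).
  by rewrite rmorph0 rmorphB /= ev_scale evX evZ mulr0 subr0.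
have linY : ~ mdvd cY F.
  apply: ndl; first exact: dhomog_cY.
  apply: contra_neq (oner_neq0 K) => /(congr1 (ev idfun 0 1 0)).
  by rewrite rmorph0 evY.
have swapF : Defs.pcomp swapXZ F = F.
  have [c c0 E] := inv _ (PGL2_swap q); rewrite E.
  rewrite pcomp_swap in E; rewrite [c](_ : c = 1) ?scale1r //.
  (* The swap is the reflection with mirror X = Z. *)
  apply: (reflection_char h2 F0 (linX 1) _ _ _ _ _ _ E);
    rewrite ?subst3X ?subst3Y ?subst3Z ?subrr ?scale1r //; try exact: mdvd0.
  - by exists 1; rewrite mulr1.
  - by exists (-1); rewrite mulrN1 opprB.
have dilatF (b : K) : b ^+ q = b -> b != 0 -> Defs.pcomp (dilat b) F = b ^+ d *: F.
  move=> hb b0; have [c c0 E] := inv _ (PGL2_dilat hb b0).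
  (* Dilation and swap, rescaled by 1/b, compose to the reflection (X, Y, Z) -> (bZ, Y, X/b) with
     mirror X = bZ; by homogeneity the rescaling contributes b^(-d). *)
  have E2 : subst3 (b *: cZ) cY (b^-1 *: cX) F = (b ^- d * c) *: F.
    have Es : Defs.pcomp swapXZ (Defs.pcomp (dilat b) F) = c *: F.
      by rewrite E pcomp_swap subst3_scale -pcomp_swap swapF.
    apply: (@scalerI _ _ (b ^+ d)); first by rewrite expf_neq0.
    rewrite scalerA mulrA divff ?expf_neq0 // mul1r -Es pcomp_swap pcomp_dilat subst3_comp.
    rewrite !subst3_scale subst3X subst3Y subst3Z -mul_mpolyC rmorphXn /=.
    rewrite /subst3 -(ev_homog _ _ _ _ _ hF) !mul_mpolyC !scalerA -expr2.
    by rewrite (divff b0) scale1r.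
  have : b ^- d * c = 1.
    apply: (reflection_char h2 F0 (linX b) _ _ _ _ _ _ E2);
      rewrite ?subst3_scale ?subst3X ?subst3Y ?subst3Z ?subrr //; try exact: mdvd0.
    - by exists 1; rewrite mulr1.
    - exists (- b^-1%:MP); rewrite -!mul_mpolyC.
      have e : b%:MP * (b^-1)%:MP = 1 :> {mpoly K[3]} by rewrite -rmorphM divff // rmorph1.
      by move: (b%:MP) (b^-1%:MP) e => s t e; ring: e.
    - by rewrite scalerA (divff b0) scale1r.
    - by rewrite scalerA (mulVf b0) scale1r.
  by move=> c1; rewrite E -[c]mul1r -(@divff _ (b ^+ d)) ?expf_neq0 // -mulrA c1 mulr1.
(* The dilation by -1 is the reflection with mirror Y = 0, and its multiplier is (-1)^d. *)
have de : ~~ odd d.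
  have q_o := q_odd hp_odd hq.
  have hN : (-1 : K) ^+ q = -1 by rewrite -signr_odd q_o.
  have N0 : (-1 : K) != 0 by rewrite oppr_eq0 oner_eq0.
  have E := dilatF _ hN N0.
  rewrite pcomp_dilat sqrrN expr1n scale1r in E.
  have : (-1 : K) ^+ d = 1.
    apply: (reflection_char h2 F0 linY _ _ _ _ _ _ E);
      rewrite ?subst3_scale ?subst3X ?subst3Y ?subst3Z ?subrr //; try exact: mdvd0.
    - by exists 2%:R; rewrite scaleN1r opprK; ring.
    - by rewrite scalerA mulrNN mulr1 scale1r.
  rewrite -signr_odd; case: (odd d) => // /eqP.
  by rewrite expr1 -subr_eq0 -opprD oppr_eq0 (negPf h2).
split=> //; split=> // a ha.
have [c c0 E] := inv _ (PGL2_transl ha); rewrite E.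
suff -> : c = 1 by rewrite scale1r.
(* On the conic a translation only shifts the parameter, which preserves the leading coefficient; as
   the restriction is nonzero, the multiplier c is 1. *)
have g0 : conic_res F != 0.
  apply/eqP => /(quadric_dvd h2 hF); apply: irreducible_not_dvd => //.
  by rewrite (msize_dhomog (quadric_neq0 K) (dhomog_quadric K)) sF !ltnS.
have := congr1 (fun G => lead_coef (conic_res G)) E.
rewrite /= conic_res_transl // conic_res_scale lead_coefZ lead_coef_comp ?size_XaddC //.
rewrite lead_coefXaddC expr1n mulr1 => /eqP.
by rewrite -[X in X == _]mul1r (inj_eq (mulIf _)) ?lead_coef_eq0 // eq_sym => /eqP.
Qed.

End Structure.

Theorem mainTheorem14 (p h q : nat) (K : closedFieldType)
  (hp : prime p) (hp_odd : odd p) (hh : (0 < h)%N) (hq : q = (p ^ h)%N)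
  (hchar : p \in [pchar K])
  (halg : forall x : K, exists2 n : nat, (0 < n)%N & x ^+ (q ^ n) = x)
  (F : {mpoly K[3]}) (d : nat)
  (hF0 : F != 0) (hhom : F \is d.-homog) (hirr : irreducible_mpoly F)
  (hd : (2 < d < q ^ 2 - q)%N)
  (hinv : forall M : 'M[K]_3, inPGL2 q M -> curve_invariant M F) :
  (exists2 c : K, c != 0 & F = c *: (hermitian_curve q))
  \/ (exists lam : K, exists2 c : K, c != 0 & F = c *: (curve_family q lam)).
Proof.
have [d2 dlt] := andP hd.
have [oF de] := irreducible_orth_inv hp hp_odd hh hq hchar hF0 hhom hirr d2 hinv.
rewrite -(even_halfK de) in oF dlt.
have [r [k [P [_ sP EF]]]] := orth_inv_structure hp hp_odd hh hq hchar oF dlt.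
have sF : (3 < msize F)%N by rewrite (msize_dhomog hF0 hhom).
have [lam [c [c0 E]]] := pencil_member hp hp_odd hh hq hchar hirr sF sP EF.
(* The Hermitian curve is the member [lam = 0] of the family. *)
by right; exists lam, c => //; rewrite E /curve_family divn2.
Qed.
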